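(* If $G$ is a graph of order $n$ whose Seidel matrix is singular, then $n\equiv 1\pmod 4$.
   Context: All graphs are simple, undirected, finite, with at least one vertex. The order of a graph is its number of vertices. For a graph $G$ with vertices $v_1,\dots,v_n$ and adjacency matrix $A$, the Seidel matrix of $G$ is $S=J_n-I_n-2A$, where $J_n$ is the all-ones $n\times n$ matrix and $I_n$ the identity. *)

(* Defs.v *)
From HB Require Import structures.
From mathcomp Require Import all_boot all_order all_algebra.

Set Implicit Arguments.
Unset Strict Implicit.
Unset Printing Implicit Defensive.

Import GRing.Theory.

Record sgraph := SGraph {
  vertex : finType;
  vertex_gt0 : 0 < #|vertex|;
  adj : rel vertex;
  adj_sym : symmetric adj;
  adj_irr : irreflexive adj
}.

Definition gorder (G : sgraph) : nat := #|vertex G|.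

Local Open Scope ring_scope.

(* The vertices are listed in the order of enum; another order conjugates the
   matrix by a permutation matrix. *)
Definition adjacency (R : pzRingType) (G : sgraph) : 'M[R]_(gorder G) :=
  \matrix_(i, j) (adj (enum_val i) (enum_val j))%:R.

Definition seidel (R : pzRingType) (G : sgraph) : 'M[R]_(gorder G) :=
  const_mx 1 - 1%:M - 2%:R *: adjacency R G.

(* Main.v *)
Require Import Defs.
From HB Require Import structures.
From mathcomp Require Import all_boot all_order all_algebra.
From mathcomp Require Import ring zify.

Set Implicit Arguments.
Unset Strict Implicit.
Unset Printing Implicit Defensive.

Import GRing.Theory.
Local Open Scope ring_scope.

(* A singular integer matrix has a nonzero integer kernel vector, which may be
   halved until it has an odd entry. If v is such a vector and s is the sum of
   its entries, then v S = 0 reads s = v_j + 2 (v A)_j, so every v_j is odd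
   together with s. Moreover s^2 = sum_j v_j^2 + 2 v A v^T, where v A v^T is
   even because A is symmetric with zero diagonal. Odd squares being 1 modulo 4,
   this gives 1 = n modulo 4. *)

(** Moves the singularity hypothesis from [R] to [int], where parity makes sense. *)
Lemma map_seidel (R : pzRingType) (G : sgraph) :
  seidel R G = map_mx intr (seidel int G).
Proof.
by apply/matrixP=> i j; rewrite !mxE !rmorphB /= rmorphM /= !rmorph_nat.
Qed.

(** Transposition matches the terms above the diagonal with those below it, so the sum is twice the
    lower triangle [t]. *)
Lemma dvdz2_sum_symmetric n (f : 'I_n -> 'I_n -> int)
    (f_sym : forall i j, f i j = f j i) (f_diag : forall i, f i i = 0) :
  (2 %| \sum_i \sum_j f i j)%Z.
Proof.
pose t := \sum_(i < n) \sum_(j < n | (j < i)%N) f i j.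
suff ->: \sum_i \sum_j f i j = t * 2 by apply: dvdz_mull.
have -> : t * 2 = t + \sum_(i < n) \sum_(j < n | (i < j)%N) f i j.
  rewrite mulr_natr mulr2n {2}/t; congr (_ + _).
  rewrite (exchange_big_dep predT) //=.
  by do 2![apply: eq_bigr => ? _]; apply: f_sym.
rewrite -big_split; apply: eq_bigr => i _ /=.
rewrite (bigID (fun j : 'I_n => (j < i)%N)) /=; congr (_ + _).
rewrite (bigD1 i) ?ltnn //= f_diag add0r; apply: eq_bigl => j.
by rewrite -leqNgt ltn_neqAle andbC eq_sym.
Qed.

Lemma sqr_odd_mod4 (x : int) : ~~ (2 %| x)%Z -> (x ^+ 2 = 1 %[mod 4])%Z.
Proof.
move=> x_odd; have [k ->] : exists k, x = 2 * k + 1 by exists (x %/ 2)%Z; lia.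
apply/eqP; rewrite eqz_mod_dvd; apply/dvdzP; exists (k ^+ 2 + k); ring.
Qed.

Lemma sum_mod (I : finType) (f g : I -> int) (d : int) :
  (forall i, (f i = g i %[mod d])%Z) ->
  (\sum_i f i = \sum_i g i %[mod d])%Z.
Proof.
move=> fg; apply/eqP; rewrite eqz_mod_dvd -sumrB; apply: rpred_sum => i _.
by rewrite -eqz_mod_dvd; apply/eqP.
Qed.

Section SeidelKernel.

Variables (G : sgraph) (v : 'rV[int]_(gorder G)).
Hypothesis vS : v *m seidel int G = 0.

Let A := adjacency int G.

Lemma seidel_kernelE j : \sum_i v 0 i = v 0 j + 2 * \sum_i v 0 i * A i j.
Proof.
have /matrixP/(_ 0 j) := vS; rewrite /seidel -/A !mulmxBr mulmx1 -scalemxAr.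
rewrite !mxE (eq_bigr (v 0)) => [|i _]; last by rewrite mxE mulr1.
by move/eqP; rewrite -addrA -opprD subr_eq0 => /eqP.
Qed.

Lemma seidel_kernel_odd i j : ~~ (2 %| v 0%R i)%Z -> ~~ (2 %| v 0%R j)%Z.
Proof. by have := seidel_kernelE i; rewrite (seidel_kernelE j); lia. Qed.

Lemma seidel_kernel_mod4 i : ~~ (2 %| v 0%R i)%Z -> gorder G = 1%N %[mod 4].
Proof.
move=> vi_odd; set s := \sum_i v 0 i.
have v_odd j : ~~ (2 %| v 0%R j)%Z := seidel_kernel_odd j vi_odd.
have s_odd : ~~ (2 %| s)%Z.
  by have := v_odd i; rewrite /s (seidel_kernelE i); lia.
(* Multiply [seidel_kernelE j] by [v 0 j] and sum over [j]. *)
have sqr_s : s ^+ 2 = \sum_j v 0 j ^+ 2 +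
    2 * \sum_j \sum_i (v 0 i * A i j * v 0 j).
  rewrite expr2 {2}/s mulr_sumr mulr_sumr -big_split; apply: eq_bigr => j _ /=.
  rewrite {1}/s (seidel_kernelE j) -mulr_suml; ring.
have /dvdzP[e e_eq] : (2 %| \sum_j \sum_i (v 0 i * A i j * v 0 j)%R)%Z.
  apply: dvdz2_sum_symmetric => [j k|j]; last by rewrite mxE adj_irr mulr0 mul0r.
  by rewrite !mxE adj_sym; ring.
(* Modulo 4 the cross term [2 * (e * 2)] vanishes and the sum of odd squares is [gorder G]. *)
have := sqr_odd_mod4 s_odd; rewrite sqr_s e_eq.
have := sum_mod (fun j => sqr_odd_mod4 (v_odd j)).
rewrite sumr_const card_ord; move: (\sum_j _) => q; lia.
Qed.

End SeidelKernel.

(** Descent on the sum of the absolute values of the entries: if all are even, [v] can be halved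
    within the kernel. *)
Lemma kernel_odd_entry m n (M : 'M[int]_(m, n)) (v : 'rV_m) :
  v != 0 -> v *m M = 0 ->
  exists w : 'rV_m, w *m M = 0 /\ exists i, ~~ (2 %| w 0%R i)%Z.
Proof.
have [k] := ubnP (\sum_i `|v 0%R i|)%N.
elim: k v => // k IHk v lt_k v_neq0 vM.
case: (pickP (fun i => ~~ (2 %| v 0%R i)%Z)) => [i vi | v_even].
  by exists v; split=> //; exists i.
pose w := map_mx (divz^~ 2) v.
have v_eq : v = 2 *: w.
  apply/rowP=> i; rewrite !mxE mulrC; apply/esym/eqP.
  by rewrite -dvdz_eq; apply/negbFE/v_even.
have w_neq0 : w != 0 by apply: contraNneq v_neq0 => w0; rewrite v_eq w0 scaler0.
apply: (IHk w) => //; last first.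
  apply/eqP; move/eqP: vM; rewrite v_eq -scalemxAl.
  by rewrite scalemx_eq0.
have : (\sum_i `|v 0%R i| = 2 * \sum_i `|w 0%R i|)%N.
  by rewrite big_distrr /=; apply: eq_bigr => i _; rewrite v_eq mxE abszM.
(* Halving lowers the sum strictly only because it is positive. *)
have : (0 < \sum_i `|w 0%R i|)%N.
  rewrite lt0n sum_nat_eq0; apply: contra w_neq0 => /forall_inP w0.
  by apply/eqP/rowP=> i; rewrite [RHS]mxE; apply/eqP; rewrite -absz_eq0 w0.
move: lt_k; do 2![move: (\sum_i _)%N => ?]; lia.
Qed.

Theorem corollary3p3 (R : realFieldType) (G : sgraph) (n : nat)
    (Gn : gorder G = n) (singularS : seidel R G \notin unitmx) :
  n = 1%N %[mod 4].
Proof.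
rewrite -Gn; move: singularS.
(* As [R] has characteristic zero, the determinant already vanishes in [int], an integral domain, so
   [det0P] yields an integer kernel vector. *)
rewrite unitmxE unitfE negbK map_seidel det_map_mx intr_eq0.
move=> /det0P[v v_neq0 vS].
have [w [wS [i wi]]] := kernel_odd_entry v_neq0 vS.
exact: seidel_kernel_mod4 wS i wi.
Qed.
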